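(* Let $f_L=1+X+Y\in\mathbb{F}_2[X^{\pm1},Y^{\pm1}]$ and let $X_{f_L}$ be the Ledrappier subshift, i.e. the set of all $c\in\mathbb{F}_2[[X^{\pm1},Y^{\pm1}]]$ with $f_Lc=0$. Then any low complexity $c\in X_{f_L}$ is periodic.
   Context: $\mathbb{F}_2[X^{\pm1},Y^{\pm1}]$ is the ring of Laurent polynomials over the two-element field, and $\mathbb{F}_2[[X^{\pm1},Y^{\pm1}]]$ is the set of formal two-sided power series $c=\sum_{(i,j)\in\mathbb{Z}^2}c_{i,j}X^iY^j$ (equivalently, configurations $c\in\mathbb{F}_2^{\mathbb{Z}^2}$), a module over the Laurent polynomial ring under the formal product. The translation by $\mathbf{t}\in\mathbb{Z}^2$ is $\tau_{\mathbf{t}}(c)_{\mathbf{n}}=c_{\mathbf{n}-\mathbf{t}}$. A configuration $c$ is periodic if $\tau_{\mathbf{t}}(c)=c$ for some non-zero $\mathbf{t}\in\mathbb{Z}^2$. For a finite $D\subset\mathbb{Z}^2$, $P(c,D)=\{\tau_{\mathbf{t}}(c)_{|D} : \mathbf{t}\in\mathbb{Z}^2\}$ is the set of $D$-patterns of $c$. The configuration $c$ has low complexity if $|P(c,D)|\le|D|$ for some finite $D\subset\mathbb{Z}^2$ (of any shape). *)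

(* Defs.v *)
From HB Require Import structures.
From mathcomp Require Import all_boot all_order all_algebra finmap.
From mathcomp Require Import boolp classical_sets.
From mathcomp.multinomials Require Import monalg.

Set Implicit Arguments.
Unset Strict Implicit.
Unset Printing Implicit Defensive.

Import GRing.Theory.
Local Open Scope ring_scope.

Definition Z2 : zmodType := (int * int)%type.

(* Elements of F_2[X^{+-1}, Y^{+-1}]: finitely supported families of
   coefficients indexed by Z^2, with << (i, j) >> the monomial X^i Y^j. The
   ring product of {malg _[_]} is unavailable here, since monalg asks that the
   monomials have no nontrivial units; only the action on series is needed. *)
Definition laurent : zmodType := {malg 'F_2[Z2]}.

(* Elements of F_2[[X^{+-1}, Y^{+-1}]], as coefficient functions. *)
Definition config : Type := Z2 -> 'F_2.

(* Coefficient of X^i Y^j, (i, j) = n, in the formal product f c. *)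
Definition laurent_act (f : laurent) (c : config) : config :=
  fun n => \sum_(u <- msupp f) f@_u * c (n - u).

Definition translate (t : Z2) (c : config) : config := fun n => c (n - t).

Definition periodic (c : config) : Prop :=
  exists2 t : Z2, t != 0 & translate t c = c.

Definition restrict (D : {fset Z2}) (c : config) : {ffun D -> 'F_2} :=
  [ffun d : D => c (val d)].

Definition patterns (c : config) (D : {fset Z2}) : {set {ffun D -> 'F_2}} :=
  [set p | `[< exists t : Z2, p = restrict D (translate t c) >]]%SET.

Definition low_complexity (c : config) : Prop :=
  exists D : {fset Z2}, (#|patterns c D| <= #|` D|)%N.

Definition subshift (f : laurent) : set config :=
  [set c | laurent_act f c = (fun=> 0)]%classic.

Definition LX : laurent := << ((1, 0) : Z2) >>.
Definition LY : laurent := << ((0, 1) : Z2) >>.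
Definition L1 : laurent := << (0 : Z2) >>.

Definition f_L : laurent := L1 + LX + LY.

(* Main.v *)
Require Import Defs.
From mathcomp Require Import all_boot all_algebra classical_sets.
From HB Require Import structures.
From mathcomp Require Import all_order finfield finmap boolp functions zify.
From mathcomp.multinomials Require Import monalg.

(* Let D be the finite shape and lift c to a 0/1-valued integer configuration.
   Its at most |D| patterns are points of Z^D, so they lie on a common
   hyperplane sum_d a_d x_d = const with integer coefficients: the Laurent
   polynomial g = sum_d a_d X^(-d) sends the lift of c to a constant, hence
   annihilates the bounded configuration b = (1 - X) c. For a prime p,
   g(X^p, Y^p) = g^p mod p, so all values of g(X^p, Y^p) b are multiples of p;
   when p is larger than sum_d |a_d| they are too small to be nonzero (Kari and
   Szabados). So g(X^k, Y^k) annihilates b for all k = 1 + j t, with t a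
   suitable factorial. Eliminating the monomials of g one by one gives an
   annihilator prod_i (1 - X^(v_i)) of c with every v_i nonzero. Modulo 2, and
   on the Ledrappier subshift, Y acts as 1 + X, which turns this product into a
   nonzero polynomial Q(X) annihilating c. Since Q divides some X^j - X^i with
   i < j, the configuration is horizontally periodic. *)

Set Implicit Arguments.
Unset Strict Implicit.
Unset Printing Implicit Defensive.

Import Order.TTheory GRing.Theory Num.Theory.
Local Open Scope ring_scope.

(** * The ring of additive endomorphisms *)

Section AdditiveEndomorphisms.

Variable V : zmodType.
Implicit Types (f g h : {additive V -> V}) (x : V).

HB.instance Definition _ := gen_eqMixin {additive V -> V}.
HB.instance Definition _ := gen_choiceMixin {additive V -> V}.

Lemma endo_ext f g : f =1 g -> f = g.
Proof.
case: f g => [f [[f_add]]] [g [[g_add]]] /= /funext fg.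
by move: f_add; rewrite fg => f_add; rewrite (Prop_irrelevance f_add g_add).
Qed.

Definition endo_zero : {additive V -> V} := \0.
Definition endo_opp f : {additive V -> V} := \- f.
Definition endo_add f g : {additive V -> V} := f \+ g.
Definition endo_one : {additive V -> V} := idfun.
Definition endo_comp f g : {additive V -> V} := f \o g.

Lemma endo_addA : associative endo_add.
Proof. by move=> f g h; apply: endo_ext => x; apply: addrA. Qed.

Lemma endo_addC : commutative endo_add.
Proof. by move=> f g; apply: endo_ext => x; apply: addrC. Qed.

Lemma endo_add0 : left_id endo_zero endo_add.
Proof. by move=> f; apply: endo_ext => x; apply: add0r. Qed.

Lemma endo_addN : left_inverse endo_zero endo_opp endo_add.
Proof. by move=> f; apply: endo_ext => x; apply: addNr. Qed.

HB.instance Definition _ := GRing.isZmodule.Build {additive V -> V}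
  endo_addA endo_addC endo_add0 endo_addN.

Lemma endo_compA : associative endo_comp.
Proof. by move=> f g h; apply: endo_ext. Qed.

Lemma endo_comp1l : left_id endo_one endo_comp.
Proof. by move=> f; apply: endo_ext. Qed.

Lemma endo_comp1r : right_id endo_one endo_comp.
Proof. by move=> f; apply: endo_ext. Qed.

Lemma endo_compDl : left_distributive endo_comp endo_add.
Proof. by move=> f g h; apply: endo_ext. Qed.

Lemma endo_compDr : right_distributive endo_comp endo_add.
Proof. by move=> f g h; apply: endo_ext => x; apply: raddfD. Qed.

HB.instance Definition _ := GRing.Zmodule_isPzRing.Build {additive V -> V}
  endo_compA endo_comp1l endo_comp1r endo_compDl endo_compDr.

Definition endo_eval x f : V := f x.

Lemma endo_eval_is_zmod_morphism x : zmod_morphism (endo_eval x).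
Proof. by []. Qed.

HB.instance Definition _ x := GRing.isZmodMorphism.Build {additive V -> V} V
  (endo_eval x) (endo_eval_is_zmod_morphism x).

Lemma endo_mulE f g (x : V) : (f * g) x = f (g x).
Proof. by []. Qed.

Lemma endo_subE f g (x : V) : (f - g) x = f x - g x.
Proof. by []. Qed.

Lemma endo_sumE (I : Type) (r : seq I) (P : pred I)
    (F : I -> {additive V -> V}) (x : V) :
  (\sum_(i <- r | P i) F i) x = \sum_(i <- r | P i) F i x.
Proof. exact: (raddf_sum (endo_eval x)). Qed.

Lemma endo_mulrzE f (n : int) (x : V) : (f *~ n) x = f x *~ n.
Proof. exact: (raddfMz (endo_eval x)). Qed.

End AdditiveEndomorphisms.

Lemma endo_fct_oner_neq0 (G : zmodType) (R : nzRingType) :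
  1 != 0 :> {additive (G -> R) -> (G -> R)}.
Proof.
apply/eqP => /(congr1 (fun f : {additive (G -> R) -> (G -> R)} => f 1 0)) /eqP.
by rewrite oner_eq0.
Qed.

HB.instance Definition _ (G : zmodType) (R : nzRingType) :=
  GRing.PzSemiRing_isNonZero.Build {additive (G -> R) -> (G -> R)}
    (endo_fct_oner_neq0 G R).

Lemma pchar_endo_fct (G : zmodType) (R : nzRingType) (p : nat) :
  p \in [pchar R] -> p \in [pchar {additive (G -> R) -> (G -> R)}].
Proof.
move=> charRp; rewrite inE (pcharf_prime charRp); apply/eqP/endo_ext => c.
rewrite pmulrn endo_mulrzE -pmulrn; apply: funext => n.
by rewrite natmulfctE mulrn_pchar.
Qed.

Lemma expr_sum_pchar_comm (A : nzRingType) (p : nat) (I : Type) (r : seq I)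
    (F : I -> A) :
    p \in [pchar A] -> (forall i j, GRing.comm (F i) (F j)) ->
  (\sum_(i <- r) F i) ^+ p = \sum_(i <- r) F i ^+ p.
Proof.
move=> charAp commF; elim: r => [|i r IHr].
  by rewrite !big_nil -(pFrobenius_autE charAp) pFrobenius_aut0.
rewrite !big_cons -IHr -!(pFrobenius_autE charAp) pFrobenius_autD_comm //.
exact: commr_sum.
Qed.

(* Combining the relations with the coefficients of \prod_(i <- r) ('X - x i)
   leaves only the term in y i0. *)
Lemma geometric_relations_prod (V : zmodType) (I : Type) (i0 : I) (r : seq I)
    (x : I -> {additive V -> V}) (y : I -> V) :
    (forall i j, GRing.comm (x i) (x j)) ->
    (forall j, \sum_(i <- i0 :: r) (x i ^+ j) (y i) = 0) ->
  (\prod_(i <- r) (x i0 - x i)) (y i0) = 0.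
Proof.
move=> commx; elim: r y => [|i1 r IHr] y rel.
  by have := rel 0%N; rewrite big_seq1 big_nil.
have commB i j k : GRing.comm (x i - x j) (x k).
  by apply/commr_sym/commrB.
have comm_prod : GRing.comm (x i0 - x i1) (\prod_(i <- r) (x i0 - x i)).
  by apply: commr_prod => i _; apply: commrB.
rewrite big_cons comm_prod; apply: (IHr (fun i => (x i - x i1) (y i))) => j.
have eliminated i :
    (x i ^+ j) ((x i - x i1) (y i)) =
    (x i ^+ j.+1) (y i) - x i1 ((x i ^+ j) (y i)).
  by rewrite -endo_mulE mulrBr -exprSr -(commrX j (commx i1 i)).
transitivity (\sum_(i <- [:: i0, i1 & r]) (x i ^+ j) ((x i - x i1) (y i))).
  by rewrite !big_cons subrr raddf0 add0r.
rewrite (eq_bigr _ (fun i _ => eliminated i)) sumrB rel -raddf_sum rel raddf0.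
by rewrite subr0.
Qed.

(** * Laurent polynomials with integer coefficients acting by translations *)

Section Translations.

Variables G M : zmodType.
Implicit Types (u v : G) (c : G -> M).

Definition shift u c : G -> M := fun n => c (n - u).

Lemma shift_is_zmod_morphism u : zmod_morphism (shift u).
Proof. by []. Qed.

HB.instance Definition _ u :=
  GRing.isZmodMorphism.Build (G -> M) (G -> M) (shift u)
    (shift_is_zmod_morphism u).

Definition tau u : {additive (G -> M) -> (G -> M)} := shift u.

Lemma tau0 : tau 0 = 1.
Proof.
by apply: endo_ext => c; apply: funext => n; rewrite /= /shift subr0.
Qed.

Lemma tauD u v : tau (u + v) = tau u * tau v.
Proof.
by apply: endo_ext => c; apply: funext => n; rewrite /= /shift opprD addrA.
Qed.

Lemma tauK u : cancel (tau u) (tau (- u)).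
Proof.
by move=> c; apply: funext => n; rewrite /= /shift opprK addrK.
Qed.

Lemma tau_comm u v : GRing.comm (tau u) (tau v).
Proof. by rewrite /GRing.comm -!tauD addrC. Qed.

Lemma tauMn u k : tau (u *+ k) = tau u ^+ k.
Proof. by elim: k => [|k IHk]; rewrite ?tau0 // mulrS tauD IHk exprS. Qed.

Lemma tau_mul_diff u v : tau v * (1 - tau (u - v)) = tau v - tau u.
Proof. by rewrite mulrBr mulr1 -tauD addrCA subrr addr0. Qed.

Definition diffs_op (us : seq G) : {additive (G -> M) -> (G -> M)} :=
  \prod_(u <- us) (1 - tau u).

Lemma diffs_op_rcons (us : seq G) u :
  diffs_op (rcons us u) = diffs_op us * (1 - tau u).
Proof. exact: big_rcons. Qed.

(* For f = \sum_i a_i X^(v_i), this is the action of f(X^k). *)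
Definition dilated_op (I : finType) (a : I -> int) (v : I -> G) (k : nat) :
    {additive (G -> M) -> (G -> M)} :=
  \sum_i tau (v i *+ k) *~ a i.

End Translations.

Arguments tau {G M} u.
Arguments diffs_op {G M} us.
Arguments dilated_op {G M I} a v k.
Arguments tauMn {G M} u k.

Lemma mulrzfctE (T : Type) (M : zmodType) (f : T -> M) (z : int) :
  f *~ z = (fun x => f x *~ z).
Proof.
by case: z => k; rewrite ?NegzE ?mulrNz -pmulrn natmulfctE.
Qed.

Lemma ltn_prime_dvd_succ_fact (N j p : nat) :
  prime p -> (p %| 1 + j * N`!)%N -> (N < p)%N.
Proof.
move=> p_pr; apply: contraTltn => p_le_N.
rewrite dvdn_addl ?Euclid_dvd1 //.
by rewrite dvdn_mull // dvdn_fact // prime_gt0.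
Qed.

Section Dilations.

Variables (G : zmodType) (I : finType) (a : I -> int) (v : I -> G).

Lemma dilated_opE (M : zmodType) (k : nat) (c : G -> M) (n : G) :
  dilated_op a v k c n = \sum_i c (n - v i *+ k) *~ a i.
Proof.
rewrite endo_sumE fct_sumE; apply: eq_bigr => i _.
by rewrite endo_mulrzE mulrzfctE.
Qed.

Lemma dilated_op_comp (M N : zmodType) (f : {additive M -> N}) (k : nat)
    (c : G -> M) :
  dilated_op a v k (f \o c) = f \o dilated_op a v k c.
Proof.
apply: funext => n /=; rewrite !dilated_opE raddf_sum.
by apply: eq_bigr => i _; rewrite raddfMz.
Qed.

Lemma dilated_op_pchar (R : nzRingType) (p k : nat) : p \in [pchar R] ->
  dilated_op a v (k * p) = dilated_op a v k ^+ p
    :> {additive (G -> R) -> (G -> R)}.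
Proof.
move=> /(pchar_endo_fct G) charEp.
rewrite /dilated_op expr_sum_pchar_comm //; last first.
  by move=> i j; apply/commrMz/commr_sym/commrMz/tau_comm.
apply: eq_bigr => i _; rewrite mulrnA (tauMn _ p).
by rewrite -!(pFrobenius_autE charEp) pFrobenius_autMz.
Qed.

Lemma dilated_op_pchar_eq0 (R : nzRingType) (p k : nat) (c : G -> R) :
    p \in [pchar R] -> dilated_op a v k c = 0 ->
  dilated_op a v (k * p) c = 0.
Proof.
move=> charRp kc; rewrite dilated_op_pchar //.
case: p charRp => [/pcharf_prime //|p _].
by rewrite exprSr /= kc raddf0.
Qed.

Lemma dvdz_dilated_op (p k : nat) (c : G -> int) (n : G) :
    prime p -> dilated_op a v k c = 0 ->
  (p %| dilated_op a v (k * p) c n)%Z.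
Proof.
move=> p_pr kc; have charFp := pchar_Fp p_pr.
pose reduce : {additive int -> 'F_p} := intr.
rewrite (dvdz_pcharf charFp); apply/eqP.
rewrite -[LHS]/((reduce \o dilated_op a v (k * p) c) n) -dilated_op_comp.
rewrite dilated_op_pchar_eq0 // dilated_op_comp kc.
by apply: funext => m; apply: raddf0.
Qed.

Lemma absz_dilated_op_le (B k : nat) (c : G -> int) (n : G) :
    (forall m, (`|c m| <= B)%N) ->
  (`|dilated_op a v k c n| <= B * \sum_i `|a i|)%N.
Proof.
move=> c_le_B; rewrite dilated_opE -lez_nat abszE.
apply: le_trans (ler_norm_sum _ _ _) _.
rewrite big_distrr (big_morph Posz PoszD (erefl _)); apply: ler_sum => i _.
by rewrite mulrzz normrM -!abszE -PoszM lez_nat leq_mul.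
Qed.

Lemma dilated_op_prime_eq0 (B p k : nat) (c : G -> int) :
    prime p -> (B * \sum_i `|a i| < p)%N -> (forall m, (`|c m| <= B)%N) ->
    dilated_op a v k c = 0 ->
  dilated_op a v (k * p) c = 0.
Proof.
move=> p_pr lt_p c_le_B kc; apply: funext => n; apply/eqP.
have := dvdz_dilated_op n p_pr kc; rewrite dvdzE; apply: contraLR.
rewrite -absz_gt0 => /gtnNdvd -> //.
exact: leq_ltn_trans (absz_dilated_op_le _ _ c_le_B) lt_p.
Qed.

Lemma dilated_op_eq0 (B k : nat) (c : G -> int) :
    (0 < k)%N ->
    (forall p, prime p -> (p %| k)%N -> (B * \sum_i `|a i| < p)%N) ->
    (forall m, (`|c m| <= B)%N) -> dilated_op a v 1 c = 0 ->
  dilated_op a v k c = 0.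
Proof.
move=> + + c_le_B ann; elim/ltn_ind: k => k IHk k_gt0 large_primes.
have [k_le1|k_gt1] := leqP k 1; first by have -> : k = 1%N by lia.
have p_pr := pdiv_prime k_gt1; have p_dvd := pdiv_dvd k.
have lt_p := large_primes _ p_pr p_dvd.
rewrite -(divnK p_dvd); apply: (dilated_op_prime_eq0 p_pr lt_p c_le_B).
apply: IHk; first by rewrite ltn_Pdiv // prime_gt1.
  by rewrite divn_gt0 ?prime_gt0 // dvdn_leq.
move=> q q_pr q_dvd; apply: large_primes => //.
exact: dvdn_trans q_dvd (dvdn_div p_dvd).
Qed.

Lemma dilated_op_succ_fact_eq0 (B j : nat) (c : G -> int) :
    (forall m, (`|c m| <= B)%N) -> dilated_op a v 1 c = 0 ->
  dilated_op a v (1 + j * (B * \sum_i `|a i|)`!) c = 0.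
Proof.
move=> c_le_B; apply: dilated_op_eq0 c_le_B => // p p_pr.
exact: ltn_prime_dvd_succ_fact.
Qed.

Lemma dilated_op_addl (M : zmodType) (u : G) (k : nat) :
  dilated_op a (fun i => u + v i) k =
  tau (u *+ k) * dilated_op a v k :> {additive (G -> M) -> (G -> M)}.
Proof.
rewrite /dilated_op mulr_sumr; apply: eq_bigr => i _.
by rewrite mulrnDl tauD mulrzAr.
Qed.

Lemma dilated_op_diff_comm (M : zmodType) (u : G) (k : nat) :
  GRing.comm (dilated_op a v k) (1 - tau u : {additive (G -> M) -> (G -> M)}).
Proof.
apply: commrB; first exact: commr1.
by apply/commr_sym/commr_sum => i _; apply/commrMz/tau_comm.
Qed.

End Dilations.

(* Kari and Szabados: the relations for the dilations by 1 + j t, with t a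
   factorial, form a Vandermonde system in the X^(t v_i). *)
Lemma bounded_diffs_op_eq0 (G : zmodType) (I : finType) (a : I -> int)
    (v : I -> G) (i0 : I) (B : nat) (c : G -> int) :
    (forall (u : G) (k : nat), (u *+ k == 0) = (k == 0%N) || (u == 0)) ->
    injective v -> a i0 != 0 -> (forall n, (`|c n| <= B)%N) ->
    dilated_op a v 1 c = 0 ->
  exists2 us : seq G, 0 \notin us & diffs_op us c = 0.
Proof.
move=> mulrn_eq0G v_inj a0 c_le_B ann.
pose w i := - v i0 + v i; pose t := (B * \sum_i `|a i|)`!.
pose r := enum (predC1 i0).
exists [seq w i *+ t | i <- r].
  apply/mapP => -[i]; rewrite mem_enum inE => i_neq0 /esym/eqP.
  rewrite mulrn_eq0G eqn0Ngt fact_gt0 /w addrC subr_eq0 (inj_eq v_inj) /=.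
  by rewrite (negPf i_neq0).
have ann_dilate j : dilated_op a w (1 + j * t) c = 0.
  by apply: dilated_op_succ_fact_eq0; rewrite // dilated_op_addl /= ann raddf0.
pose x i : {additive (G -> int) -> (G -> int)} := tau (w i *+ t).
have relations j : \sum_(i <- i0 :: r) (x i ^+ j) (tau (w i) c *~ a i) = 0.
  transitivity (\sum_i (x i ^+ j) (tau (w i) c *~ a i)).
    by rewrite big_cons big_enum [RHS](bigD1 i0).
  rewrite -[RHS](ann_dilate j) [RHS]endo_sumE.
  apply: eq_bigr => i _; rewrite raddfMz endo_mulrzE -tauMn -mulrnA (mulnC t).
  by rewrite addnC mulrnDr mulr1n [in RHS]tauD.
have comm_x i j : GRing.comm (x i) (x j) by apply: tau_comm.
have w0 : w i0 = 0 by apply: addNr.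
have prod_c : diffs_op [seq w i *+ t | i <- r] c *~ a i0 = 0.
  have := geometric_relations_prod comm_x relations.
  by rewrite /x w0 mul0rn !tau0 raddfMz /diffs_op big_map.
apply: funext => n; apply/eqP; have /eqP := congr1 (@^~ n) prod_c.
by rewrite mulrzfctE mulrz_eq0 (negPf a0).
Qed.

Lemma diffs_op_comp (G M N : zmodType) (f : {additive M -> N}) (us : seq G)
    (c : G -> M) :
  diffs_op us (f \o c) = f \o diffs_op us c.
Proof.
elim/last_ind: us c => [|us u IHus] c; first by rewrite /diffs_op !big_nil.
rewrite !diffs_op_rcons /= -IHus; congr (diffs_op us _).
by apply: funext => n; apply/esym/raddfB.
Qed.

(** * Configurations of low complexity *)

Lemma exists_int_row_kernel (m n : nat) (A : 'M[int]_(m, n)) : (n < m)%N ->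
  exists2 u : 'rV[int]_m, u != 0 & u *m A = 0.
Proof.
move=> lt_nm; pose AQ : 'M[rat]_(m, n) := map_mx intr A.
have : kermx AQ != 0.
  by rewrite -mxrank_eq0 mxrank_ker; have := rank_leq_col AQ; lia.
case/rowV0Pn => w /sub_kermxP wAQ w_neq0.
have [q [d d_neq0 w_q]] := rat_poly_scale (rVpoly w).
pose u : 'rV[int]_m := poly_rV q.
have w_u : w = d%:~R^-1 *: map_mx intr u.
  apply/rowP => i; rewrite -coef_rVpoly_ord w_q coefZ coef_map.
  by rewrite !mxE.
exists u.
  by apply: contraNneq w_neq0 => u0; rewrite w_u u0 raddf0 scaler0.
have uA_rat : map_mx intr (u *m A) = 0 :> 'rV[rat]_n.
  apply/(scalerI (a := d%:~R^-1)); first by rewrite invr_eq0 intr_eq0.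
  by rewrite map_mxM scalemxAl -w_u wAQ scaler0.
apply/rowP => j; have /rowP/(_ j)/eqP := uA_rat.
by rewrite [X in X == _]mxE [X in _ == X]mxE intr_eq0 [RHS]mxE => /eqP.
Qed.

Lemma exists_int_hyperplane (I J : finType) (p : J -> I -> int) (j0 : J) :
    (#|J| <= #|I|)%N ->
  exists2 a : I -> int, exists i, a i != 0 &
    forall j, \sum_i a i * p j i = \sum_i a i * p j0 i.
Proof.
move=> le_JI; pose A : 'M[int]_(#|I|, #|predC1 j0|) :=
  \matrix_(i, j) (p (enum_val j) (enum_val i) - p j0 (enum_val i)).
have [|u /rV0Pn[i0 u_i0] uA] := exists_int_row_kernel A.
  apply: leq_trans le_JI; rewrite (cardC1 j0) ltn_predL.
  by apply/card_gt0P; exists j0.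
exists (fun i => u 0 (enum_rank i)).
  by exists (enum_val i0); rewrite enum_valK.
move=> j; have [->//|j_neq_j0] := eqVneq j j0.
have j_in : j \in predC1 j0 by [].
have /rowP/(_ (enum_rank_in j_in j)) := uA; rewrite !mxE.
rewrite (reindex _ (onW_bij _ (@enum_rank_bij I))) => uAj.
apply/eqP; rewrite -subr_eq0 -sumrB -[X in _ == X]uAj; apply/eqP/eq_bigr => i _.
by rewrite mxE !enum_rankK enum_rankK_in // mulrBr.
Qed.

Definition int_lift (c : config) : Z2 -> int := fun n => (c n : nat)%:Z.

Lemma int_liftK (c : config) : intr \o int_lift c = c.
Proof. by apply: funext => n /=; rewrite -pmulrn natr_Zp. Qed.

Lemma int_lift_le1 (c : config) (n : Z2) : 0 <= int_lift c n <= 1.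
Proof. by rewrite /int_lift; case: (c n) => [[|[|//]] ?]. Qed.

Lemma low_complexity_dilated_op_const (c : config) : low_complexity c ->
  exists (I : finType) (a : I -> int) (v : I -> Z2) (k : int),
    [/\ injective v, exists i, a i != 0 &
        dilated_op a v 1 (int_lift c) = (fun=> k)].
Proof.
case=> D few_patterns.
have patternP n : Defs.restrict D (translate (- n) c) \in patterns c D.
  by rewrite inE; apply/asboolP; exists (- n).
pose pattern n := exist (fun p => p \in patterns c D) _ (patternP n).
have [|a a_neq0 hyperplane] := @exists_int_hyperplane D {p | p \in patterns c D}
    (fun p d => (val p d : nat)%:Z) (pattern 0).
  by rewrite card_sig -cardfE.
have [k k_const] : exists k, forall n, \sum_d a d * int_lift c (n + val d) = k.
  exists (\sum_d a d * (val (pattern 0) d : nat)%:Z) => n.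
  rewrite -(hyperplane (pattern n)); apply: eq_bigr => d _.
  by rewrite ffunE /translate opprK addrC.
exists D, a, (fun d => - val d), k; split=> //.
  by move=> d e /oppr_inj/val_inj.
apply: funext => n; rewrite dilated_opE -(k_const n).
by apply: eq_bigr => d _; rewrite opprK mulrzz mulrC.
Qed.

Definition e1 : Z2 := (1, 0).
Definition e2 : Z2 := (0, 1).

Lemma Z2_mulrnE (u : Z2) (k : nat) : u *+ k = (u.1 *+ k, u.2 *+ k).
Proof. by elim: k => [|k IHk]; rewrite ?mulr0n // !mulrS IHk. Qed.

Lemma Z2_mulrn_eq0 (u : Z2) (k : nat) :
  (u *+ k == 0) = (k == 0%N) || (u == 0).
Proof.
by rewrite Z2_mulrnE; case: u => x y; rewrite !xpair_eqE !mulrn_eq0 -orb_andr.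
Qed.

Lemma low_complexity_diffs_op (c : config) : low_complexity c ->
  exists2 us : seq Z2, 0 \notin us & diffs_op us c = 0.
Proof.
case/low_complexity_dilated_op_const => I [a [v [k [v_inj [i0 a_i0] const_k]]]].
pose d := (1 - tau e1) (int_lift c).
have d_le1 n : (`|d n| <= 1)%N.
  have -> : d n = int_lift c n - int_lift c (n - e1) by [].
  have := int_lift_le1 c n; have := int_lift_le1 c (n - e1); lia.
have ann : dilated_op a v 1 d = 0.
  rewrite -endo_mulE dilated_op_diff_comm endo_mulE const_k.
  by apply: funext => n; apply: subrr.
have [us us0 us_d] := bounded_diffs_op_eq0 Z2_mulrn_eq0 v_inj a_i0 d_le1 ann.
exists (rcons us e1); first by rewrite mem_rcons inE negb_or us0.
rewrite -(int_liftK c) diffs_op_comp diffs_op_rcons /= us_d.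
by apply: funext => n; apply: raddf0.
Qed.

(** * Polynomials in one translation *)

Lemma exists_Xn_eq_mod (F : finFieldType) (Q : {poly F}) : Q != 0 ->
  exists i j : nat, (i < j)%N /\ Q %| 'X^j - 'X^i.
Proof.
move=> Q0; pose residue (i : nat) : 'rV[F]_(size Q) := poly_rV ('X^i %% Q).
have residueK i : rVpoly (residue i) = 'X^i %% Q.
  by apply: poly_rV_K; rewrite ltnW // ltn_modp.
have : ~~ injectiveb (fun i : 'I_#|'rV[F]_(size Q)|.+1 => residue i).
  by apply/injectiveP => /leq_card; rewrite card_ord ltnn.
case/injectivePn => i [j i_neq_j residue_eq].
wlog lt_ij : i j i_neq_j residue_eq / (i < j)%N.
  move=> wlog_lt; have [lt_ij|lt_ji|/val_inj eq_ij] := ltngtP i j.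
  - exact: wlog_lt lt_ij.
  - by apply: wlog_lt lt_ji; rewrite // eq_sym.
  - by rewrite eq_ij eqxx in i_neq_j.
exists i, j; split => //; rewrite /dvdp modpD modpN subr_eq0.
by rewrite -!residueK residue_eq.
Qed.

Section PolynomialAction.

Variables (G : zmodType) (R : nzRingType) (p : nat) (u : G).
Hypothesis charRp : p \in [pchar R].

Local Notation EndAlg := (pPrimeCharType (pchar_endo_fct G charRp)).

Definition poly_op : {poly 'F_p} -> {additive (G -> R) -> (G -> R)} :=
  horner_alg (tau u : EndAlg).

HB.instance Definition _ :=
  GRing.RMorphism.copy poly_op (horner_alg (tau u : EndAlg)).

Lemma poly_opX : poly_op 'X = tau u.
Proof. by rewrite /poly_op horner_algX. Qed.

Lemma poly_opM (P Q : {poly 'F_p}) (c : G -> R) :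
  poly_op (P * Q) c = poly_op P (poly_op Q c).
Proof. by rewrite rmorphM. Qed.

Lemma poly_opC (k : 'F_p) : poly_op k%:P = (k : nat)%:R.
Proof. by rewrite /poly_op horner_algC; apply: mulr1. Qed.

Lemma poly_op_tau_comm (Q : {poly 'F_p}) (w : G) :
  GRing.comm (poly_op Q) (tau w).
Proof.
elim/poly_ind: Q => [|Q k IHQ].
  by rewrite rmorph0; apply/commr_sym/commr0.
rewrite rmorphD rmorphM /= poly_opX poly_opC.
apply/commr_sym/commrD; last exact/commr_nat.
by apply: commrM; [exact/commr_sym | exact: tau_comm].
Qed.

Lemma poly_op_eq0_periodic (Q : {poly 'F_p}) (c : G -> R) :
    Q != 0 -> poly_op Q c = 0 ->
  exists2 k, (0 < k)%N & tau (u *+ k) c = c.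
Proof.
move=> Q0 Qc; have [i [j [lt_ij /dvdpP[P PQ]]]] := exists_Xn_eq_mod Q0.
exists (j - i)%N; first by rewrite subn_gt0.
have Xj_Xi_c : poly_op ('X^j - 'X^i) c = 0.
  by rewrite PQ poly_opM Qc raddf0.
have tau_ij : tau (u *+ j) c = tau (u *+ i) c.
  rewrite !tauMn -poly_opX -!rmorphXn; apply/eqP; rewrite -subr_eq0.
  by rewrite -endo_subE -rmorphB Xj_Xi_c.
rewrite mulrnBr; last exact: ltnW.
by rewrite addrC tauD endo_mulE tau_ij tauK.
Qed.

End PolynomialAction.

(** * The Ledrappier subshift *)

Lemma endo_expr_eq (V : zmodType) (x y : {additive V -> V}) (n : nat) (c : V) :
  GRing.comm x y -> x c = y c -> (x ^+ n) c = (y ^+ n) c.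
Proof.
move=> comm_xy xy_c; elim: n => // n IHn.
rewrite exprSr exprS /= xy_c -IHn.
by rewrite -endo_mulE (commr_sym (commrX n (commr_sym comm_xy))).
Qed.

Lemma subshift_diff (f : laurent) (c : config) (u : Z2) :
  subshift f c -> subshift f ((1 - tau u) c).
Proof.
move=> fc; apply: funext => n; rewrite /laurent_act.
under eq_bigr => w _ do rewrite mulrBr /= /shift addrAC.
rewrite sumrB -[X in X - _]/(laurent_act f c n).
by rewrite -[X in _ - X]/(laurent_act f c (n - u)) fc subrr.
Qed.

Lemma laurent_act_f_LE (c : config) :
  laurent_act f_L c = (1 + tau e1 + tau e2) c.
Proof.
apply: funext => n; rewrite /laurent_act.
have f_LE u : f_L@_u = (u == 0)%:R + (u == e1)%:R + (u == e2)%:R.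
  by rewrite /f_L /L1 /LX /LY !mcoeffD !mcoeffU !(eq_sym u).
have supp_f_L : perm_eq (msupp f_L) [:: 0; e1; e2].
  apply: uniq_perm; rewrite ?fset_uniq // => u.
  rewrite -mcoeff_neq0 f_LE !inE; case: (u =P 0) => [->//|_].
  by case: (u =P e1) => [->//|_]; case: (u =P e2).
have [f0 f1 f2] : [/\ f_L@_0 = 1, f_L@_e1 = 1 & f_L@_e2 = 1].
  by split; rewrite f_LE; apply/val_inj.
rewrite (perm_big _ supp_f_L) /= !big_cons big_nil f0 f1 f2 !mul1r.
by rewrite subr0 addr0 addrA.
Qed.

Lemma subshift_f_L_tau (c : config) : subshift f_L c ->
  tau e2 c = (1 + tau e1) c.
Proof.
move=> f_L_c; apply: funext => n; apply/esym/eqP.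
have := congr1 (@^~ n) f_L_c; rewrite laurent_act_f_LE => /eqP.
by rewrite addr_eq0 (oppr_pchar2 (pchar_Fp _)).
Qed.

Local Notation X_op := (poly_op e1 (pchar_Fp (isT : prime 2))).

Definition XY_poly (a b : nat) : {poly 'F_2} := 'X^a * (1 + 'X) ^+ b.

Lemma tau_XY_poly (a b : nat) (c : config) : subshift f_L c ->
  tau (e1 *+ a + e2 *+ b) c = X_op (XY_poly a b) c.
Proof.
move=> /subshift_f_L_tau f_L_c.
rewrite tauD !tauMn rmorphM !rmorphXn rmorphD rmorph1 /= poly_opX.
rewrite (endo_expr_eq b _ f_L_c) //.
by apply: commrD; [exact: commr1 | exact: tau_comm].
Qed.

Lemma XY_poly_inj (a b a' b' : nat) :
  XY_poly a b = XY_poly a' b' -> a = a' /\ b = b'.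
Proof.
have mup_XY x k l : mup x (XY_poly k l) =
    ((if 0 == x then k else 0) + (if 1 == x then l else 0))%N.
  have -> : XY_poly k l = ('X - 0%:P) ^+ k * ('X - 1%:P) ^+ l.
    by rewrite subr0 -polyCN (oppr_pchar2 (pchar_Fp _)) // addrC.
  by rewrite mupM ?expf_neq0 ?polyXsubC_eq0 // !mup_XsubCX.
move=> eq_poly; have := mup_XY 0 a b; have := mup_XY 1 a b.
by rewrite eq_poly !mup_XY /= !addn0 !add0n.
Qed.

Lemma Z2_nat_diff (v : Z2) : exists a b a' b' : nat,
  v = (e1 *+ a + e2 *+ b) - (e1 *+ a' + e2 *+ b').
Proof.
have int_nat_diff (x : int) : exists k k' : nat, x = k%:Z - k'%:Z.
  by case: x => k; [exists k, 0%N | exists 0%N, k.+1]; lia.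
case: v => x y; have [a [a' ->]] := int_nat_diff x.
have [b [b' ->]] := int_nat_diff y; exists a, b, a', b'.
rewrite !Z2_mulrnE; congr pair; rewrite /= !mul0rn !natz; lia.
Qed.

Lemma exists_X_op_diff (v : Z2) : v != 0 ->
  exists (Q : {poly 'F_2}) (w : Z2), Q != 0 /\
    forall c, subshift f_L c -> X_op Q c = tau w ((1 - tau v) c).
Proof.
have [a [b [a' [b' ->]]]] := Z2_nat_diff v => v_neq0.
exists (XY_poly a' b' - XY_poly a b), (e1 *+ a' + e2 *+ b').
split=> [|c f_L_c].
  rewrite subr_eq0; apply: contraNneq v_neq0 => /XY_poly_inj[-> ->].
  by rewrite subrr.
rewrite (raddfB X_op) -[RHS]endo_mulE tau_mul_diff !endo_subE.
by rewrite !tau_XY_poly.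
Qed.

Lemma exists_X_op_eq0 (us : seq Z2) (c : config) :
    subshift f_L c -> 0 \notin us -> diffs_op us c = 0 ->
  exists2 Q : {poly 'F_2}, Q != 0 & X_op Q c = 0.
Proof.
elim/last_ind: us c => [|us v IHus] c f_L_c.
  rewrite /diffs_op big_nil => _ c0; exists 1; first exact: oner_neq0.
  by rewrite rmorph1.
rewrite mem_rcons inE negb_or eq_sym diffs_op_rcons => /andP[v_neq0 us0] ann.
have [Q Q0 Qc] := IHus _ (subshift_diff v f_L_c) us0 ann.
have [P [w [P0 P_diff]]] := exists_X_op_diff v_neq0.
exists (Q * P); first by rewrite mulf_neq0.
rewrite poly_opM P_diff // -endo_mulE poly_op_tau_comm.
by rewrite endo_mulE Qc raddf0.
Qed.

Theorem theorem6 (c : config) :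
  subshift f_L c -> low_complexity c -> periodic c.
Proof.
move=> f_L_c /low_complexity_diffs_op[us us0 us_c].
have [Q Q0 Qc] := exists_X_op_eq0 f_L_c us0 us_c.
have [k k_gt0 tau_k] := poly_op_eq0_periodic Q0 Qc.
by exists (e1 *+ k); [rewrite Z2_mulrn_eq0 negb_or -lt0n k_gt0 | exact: tau_k].
Qed.
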